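(* Let $p$ be a positive integer, $q=p^2-p+1$, and $n\ge3$. Let $P\subset\mathbb{R}^2$ be the convex pentagon with vertices $\pm q\mathbf{e}_1$, $\pm(q-1)\mathbf{e}_1+\mathbf{e}_2$, $\tfrac qp\mathbf{e}_2$; let $P'=\{(\mathbf{x},0,\dotsc,0)\in\mathbb{R}^n:\mathbf{x}\in P\}$ and $P_n=\mathrm{conv}(P'\cup\{\mathbf{e}_3,\dotsc,\mathbf{e}_n\})\subset\mathbb{R}^n$. Let $S_n=\mathrm{conv}\{\mathbf{0},-\tfrac1p\mathbf{e}_1,\mathbf{e}_2,\dotsc,\mathbf{e}_{n-1}\}\subset\mathbb{R}^{n-1}$ and $W_n=([-q,q]\times S_n)-q\mathbf{e}_2\subset\mathbb{R}^n$. Then the convex rational polytope $H_n=\mathrm{conv}(W_n\cup P_n)\subset\mathbb{R}^n$ has period sequence $(1,p,1,\dotsc,1)$.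
   Context: $\mathbf{e}_i$ denotes the $i$th standard basis vector. For an $n$-dimensional convex rational polytope $\mathcal{P}\subset\mathbb{R}^n$ there are periodic functions $c_{\mathcal{P},i}\colon\mathbb{Z}\to\mathbb{Q}$ with finite periods such that $|k\mathcal{P}\cap\mathbb{Z}^n|=\sum_{i=0}^n c_{\mathcal{P},i}(k)k^i$ for all integers $k\ge1$; the period sequence is $(p_0,\dotsc,p_n)$ with $p_i$ the minimum period of $c_{\mathcal{P},i}$. The claimed sequence has $p_1=p$ and $p_i=1$ for $i\ne1$. *)

(* Defs.v *)
From HB Require Import structures.
From mathcomp Require Import all_boot all_order all_algebra.
From mathcomp Require Import finmap.
From mathcomp Require Import all_classical all_reals.
From mathcomp Require Import convex trigo.

Set Implicit Arguments.
Unset Strict Implicit.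
Unset Printing Implicit Defensive.

Import Order.TTheory GRing.Theory Num.Theory.

Local Open Scope classical_set_scope.
Local Open Scope ring_scope.

Section Polytopes.
Variables (R : realType) (n : nat).
Implicit Types A : set 'rV[R]_n.

Definition conv A : set 'rV[R]_n := smallest (@convex_set R 'rV[R]_n) A.

Definition rational_polytope A : Prop :=
  exists vs : seq 'rV[rat]_n,
    A = conv [set map_mx ratr v | v in [set` vs]].

(* A contains n + 1 affinely independent points: x and the x + row i M. *)
Definition full_dimensional A : Prop :=
  exists (x : 'rV[R]_n) (M : 'M[R]_n),
    [/\ A x, row_free M & forall i, A (x + row i M)].

Definition lattice_points A : set 'rV[int]_n :=
  [set z | A (map_mx intr z)].

Definition dilate (k : R) A : set 'rV[R]_n := [set k *: x | x in A].

End Polytopes.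

Definition min_period (c : int -> rat) (m : nat) : Prop :=
  [/\ (0 < m)%N, periodic c m%:Z
    & forall m' : nat, (0 < m')%N -> periodic c m'%:Z -> (m <= m')%N].

Section Ehrhart.
Variables (R : realType) (n : nat).
Implicit Types A : set 'rV[R]_n.

Definition ehrhart_coefficients A (c : nat -> int -> rat) : Prop :=
  (forall i, (i <= n)%N -> exists2 m : nat, (0 < m)%N & periodic (c i) m%:Z) /\
  (forall k : int, 1 <= k ->
     let L := lattice_points (dilate k%:~R A) in
     finite_set L /\
     #|` fset_set L|%:R = \sum_(i < n.+1) c i k * k%:~R ^+ i).

(* Periodicity makes the c i with i <= n unique, so that asking for some
   family c determines s. *)
Definition period_sequence A (s : seq nat) : Prop :=
  size s = n.+1 /\
  exists2 c, ehrhart_coefficients A c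
    & forall i, (i <= n)%N -> min_period (c i) (nth 0%N s i).

End Ehrhart.

Section Construction.
Variable R : realType.

(* The i-th standard basis vector of R^n, counting from 1 as on paper. *)
Definition bvec (n i : nat) : 'rV[R]_n := \row_(j < n) (j.+1 == i)%:R.

(* Entry j (counting from 0) of x, and 0 when j is out of range. *)
Definition coord (n : nat) (x : 'rV[R]_n) (j : nat) : R :=
  if insub j is Some j' then x 0 j' else 0.

(* (x, 0, ..., 0) in R^n. *)
Definition pad (m n : nat) (x : 'rV[R]_m) : 'rV[R]_n :=
  \row_(j < n) coord x j.

(* I x S as a subset of R^n, where S is a subset of R^(n-1). *)
Definition cylinder (n : nat) (I : set R) (S : set 'rV[R]_n.-1) :
    set 'rV[R]_n :=
  [set x | I (coord x 0) /\ S (\row_(j < n.-1) coord x j.+1)].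

Definition translate (n : nat) (v : 'rV[R]_n) (A : set 'rV[R]_n) :
    set 'rV[R]_n :=
  [set x + v | x in A].

Variables (p n : nat).

Definition qp : R := p%:R ^+ 2 - p%:R + 1.

Definition pentagon : set 'rV[R]_2 :=
  conv [set` [:: qp *: bvec 2 1;
                 - (qp *: bvec 2 1);
                 (qp - 1) *: bvec 2 1 + bvec 2 2;
                 - ((qp - 1) *: bvec 2 1) + bvec 2 2;
                 (qp / p%:R) *: bvec 2 2]].

Definition pentagon_emb : set 'rV[R]_n := [set pad n x | x in pentagon].

Definition Pn : set 'rV[R]_n :=
  conv (pentagon_emb `|` [set bvec n i | i in [set i : nat | (3 <= i <= n)%N]]).

Definition Sn : set 'rV[R]_n.-1 :=
  conv ([set 0; - (p%:R^-1 *: bvec n.-1 1)] `|`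
        [set bvec n.-1 i | i in [set i : nat | (2 <= i <= n.-1)%N]]).

Definition Wn : set 'rV[R]_n :=
  translate (- (qp *: bvec n 2)) (cylinder `[- qp, qp]%classic Sn).

Definition Hn : set 'rV[R]_n := conv (Wn `|` Pn).

End Construction.

(* Main.v *)
(** Write a point of R^n as (x, y, z) with z in R^(n-2), and s for the sum of
    the z_i. Then H_n is cut out by z >= 0, s <= 1, |x| <= q,
    p y >= - p q - (1 - s), |x| + y <= (1 - s) q and
    p^2 y + (p - 1) |x| <= (1 - s) p q. The lattice points of k H_n with
    t = k - s form a planar slice. Its lower edge contributes
    (2 k q + 1) floor(t / p), and the identity
    2 sum_(0 <= i <= t p (p-1)) floor((p-1) i / p^2)
      = (p-1) (t (p-1)) (t (p-1) - 1)
    shows that its upper edges contribute a polynomial minus floor(t / p). So a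
    slice has (a quadratic polynomial in k and t) + 2 k q floor(t / p) points.
    Summing over z is an (n-2)-fold iterated partial sum in t. It maps
    polynomials to polynomials, and floor(t / p) to a polynomial plus a function
    of minimum period p; the factor k puts that function in the coefficient
    of k^1 only. *)

From mathcomp Require Import all_boot all_order all_algebra.
From mathcomp Require Import finmap.
From mathcomp Require Import all_classical all_reals.
From mathcomp Require Import interval_inference convex trigo.
From mathcomp Require Import zify ring lra.
Require Import Defs.

Set Implicit Arguments.
Unset Strict Implicit.
Unset Printing Implicit Defensive.

Import Order.TTheory GRing.Theory Num.Theory.

Local Open Scope classical_set_scope.
Local Open Scope ring_scope.

(** * Iterated partial sums *)

Definition psum (f : nat -> rat) (k : nat) : rat := \sum_(t < k.+1) f t.

Lemma psumS f k : psum f k.+1 = psum f k + f k.+1.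
Proof. by rewrite /psum big_ord_recr. Qed.

Lemma psum0 f : psum f 0 = f 0%N.
Proof. by rewrite /psum big_ord1. Qed.

Lemma eq_psum f g : f =1 g -> psum f =1 psum g.
Proof. by move=> fg k; apply: eq_bigr. Qed.

Lemma psumD f g k : psum (fun t => f t + g t) k = psum f k + psum g k.
Proof. exact: big_split. Qed.

Lemma psumZ a f k : psum (fun t => a * f t) k = a * psum f k.
Proof. by rewrite /psum mulr_sumr. Qed.

Lemma iter_psumD r f g k :
  iter r psum (fun t => f t + g t) k = iter r psum f k + iter r psum g k.
Proof. by elim: r k => // r IH k /=; rewrite -psumD; apply: eq_psum. Qed.

Lemma iter_psumZ r a f k :
  iter r psum (fun t => a * f t) k = a * iter r psum f k.
Proof. by elim: r k => // r IH k /=; rewrite -psumZ; apply: eq_psum. Qed.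

(* The rising factorials (X + 1) ... (X + d), which psum maps to one another up to a
   constant factor. *)
Definition rising (d : nat) : {poly rat} := \prod_(i < d) ('X - (- (i.+1)%:R)%:P).

Lemma monic_rising d : rising d \is monic.
Proof. exact: monic_prod_XsubC. Qed.

Lemma size_rising d : size (rising d) = d.+1.
Proof. by rewrite /rising size_prod_XsubC -[LHS]/(_.+1) /index_enum -enumT size_enum_ord. Qed.

Lemma horner_rising d x : (rising d).[x] = \prod_(i < d) (x + (i.+1)%:R).
Proof.
by rewrite horner_prod; apply: eq_bigr => i _; rewrite hornerXsubC opprK.
Qed.

(** Telescoping: the values of [rising d.+1] at [k+1] and [k] share the factors [(k+2)...(k+d+1)],
    and the remaining factors [k+d+2] and [k+1] differ by [d+1]. *)
Lemma psum_rising d k :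
  psum (fun t => (rising d).[t%:R]) k = d.+1%:R^-1 * (rising d.+1).[k%:R].
Proof.
have d0 : d.+1%:R != 0 :> rat by rewrite pnatr_eq0.
elim: k => [|k IH].
  rewrite psum0 !horner_rising big_ord_recr /= add0r.
  by rewrite mulrCA mulVf ?mulr1.
rewrite psumS IH !horner_rising big_ord_recl [in RHS]big_ord_recr /=.
rewrite (eq_bigr (fun i : 'I_d => k.+1%:R + i.+1%:R)); last first.
  by move=> i _; rewrite -!natrD; congr (_%:R); rewrite /bump; lia.
set P := \prod_(i < d) _.
rewrite -(natr1 k) -[d.+1%:R]natr1; field.
by rewrite natr1.
Qed.

Lemma psum_poly (Q : {poly rat}) : exists2 S : {poly rat},
  (size S <= (size Q).+1)%N & forall k, psum (fun t => Q.[t%:R]) k = S.[k%:R].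
Proof.
have [d le_d] : exists d, (size Q <= d)%N by exists (size Q).
elim: d Q le_d => [|d IH] Q.
  rewrite leqn0 size_poly_eq0 => /eqP ->; exists 0; first by rewrite size_poly0.
  by move=> k; rewrite horner0 /psum big1 // => i _; rewrite horner0.
move=> le_d; have [lt_d|] := ltnP (size Q) d.+1; first exact: IH.
move=> ge_d; have sQ : size Q = d.+1 by lia.
(* [rising d] is monic of degree [d], so this cancels the leading term of [Q] and brings it under
   the induction hypothesis. *)
pose Q' := Q - Q`_d *: rising d.
have sQ' : (size Q' <= d)%N.
  apply/leq_sizeP => j; rewrite leq_eqVlt => /orP[/eqP <-|lt_dj].
    have := monic_rising d; rewrite monicE lead_coefE size_rising /= => /eqP m1.
    by rewrite coefB coefZ m1 mulr1 subrr.
  rewrite coefB coefZ [Q`_j]nth_default ?sQ //.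
  by rewrite [X in _ * X]nth_default ?mulr0 ?subr0 // size_rising.
have [S' sS' hS'] := IH Q' sQ'.
exists (S' + (Q`_d / d.+1%:R) *: rising d.+1).
  apply: leq_trans (size_polyD _ _) _; rewrite geq_max; apply/andP; split.
    by apply: leq_trans sS' _; rewrite sQ !ltnS leqW.
  by apply: leq_trans (size_scale_leq _ _) _; rewrite size_rising sQ.
move=> k; rewrite hornerD hornerZ -mulrA -psum_rising -hS' -psumZ -psumD.
by apply: eq_psum => t; rewrite -hornerZ -hornerD subrK.
Qed.

Lemma iter_psum_poly r (Q : {poly rat}) : exists2 S : {poly rat},
  (size S <= size Q + r)%N &
  forall k, iter r psum (fun t => Q.[t%:R]) k = S.[k%:R].
Proof.
elim: r => [|r [S sS hS]]; first by exists Q; rewrite ?addn0.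
have [S' sS' hS'] := psum_poly S; exists S'; first by lia.
by move=> k; rewrite -hS'; apply: eq_psum.
Qed.

(** * Periodic sequences under partial sums *)

Definition nperiodic (f : nat -> rat) (m : nat) := forall k, f (k + m)%N = f k.

Lemma nperiodicM f m j : nperiodic f m -> nperiodic f (j * m).
Proof.
move=> fm; elim: j => [|j IH] k; first by rewrite mul0n addn0.
by rewrite mulSn addnCA addnC fm IH.
Qed.

Lemma nperiodic_modn f m k : nperiodic f m -> f (k %% m)%N = f k.
Proof. by move=> fm; rewrite [in RHS](divn_eq k m) addnC (nperiodicM _ fm). Qed.

Lemma sum_nperiodic f m k :
  nperiodic f m -> \sum_(i < m) f (k + i)%N = \sum_(i < m) f i.
Proof.
move=> fm; elim: k => [|k <-]; first by apply: eq_bigr.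
case: m fm => [|m] fm; first by rewrite !big_ord0.
rewrite [LHS]big_ord_recr [RHS]big_ord_recl /= addrC addSnnS fm addn0.
by congr (_ + _); apply: eq_bigr => i _; rewrite /bump addSnnS.
Qed.

(** The increment over a full period is a sum of [m] consecutive values, which is zero wherever it
    starts. *)
Lemma psum_nperiodic f m : (0 < m)%N ->
  nperiodic f m -> \sum_(i < m) f i = 0 -> nperiodic (psum f) m.
Proof.
move=> m0 fm f0 k; rewrite /psum -addSn big_split_ord /=.
by rewrite [X in _ + X](sum_nperiodic k.+1 fm) f0 addr0.
Qed.

Definition nmin_period f m :=
  [/\ (0 < m)%N, nperiodic f m
    & forall m', (0 < m')%N -> nperiodic f m' -> (m <= m')%N].

(* Subtracting the mean from the periodic part makes its partial sums periodic,
   so each summation puts everything but one periodic function into the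
   polynomial; differencing recovers the period. *)
Lemma psum_quasi_poly (A : {poly rat}) psi m : nmin_period psi m ->
  exists2 A' : {poly rat}, (size A' <= (maxn 1 (size A)).+1)%N &
  exists2 psi', nmin_period psi' m &
    forall k, psum (fun t => A.[t%:R] + psi t) k = A'.[k%:R] + psi' k.
Proof.
case=> m0 pm minm; pose mu := (\sum_(i < m) psi i) / m%:R.
have mnz : m%:R != 0 :> rat by rewrite pnatr_eq0 -lt0n.
have [A' sA' hA'] := psum_poly (A + mu%:P).
exists A'.
  apply: leq_trans sA' _; rewrite ltnS; apply: leq_trans (size_polyD _ _) _.
  by rewrite geq_max leq_maxr (leq_trans (size_polyC_leq1 _)) ?leq_maxl.
exists (psum (fun t => psi t - mu)); last first.
  move=> k; rewrite -hA' -psumD; apply: eq_psum => t.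
  by rewrite hornerD hornerC addrACA subrr addr0.
split=> // [|m' m'0 pm'].
  apply: psum_nperiodic => // [k|]; first by rewrite pm.
  rewrite sumrB sumr_const card_ord -mulr_natr /mu.
  by rewrite divfK ?subrr.
(* Consecutive partial sums recover [psi] only at positive arguments; a shift by [m] then covers
   0. *)
apply: minm => // k; have Eh j : (0 < j)%N -> psi (j + m')%N = psi j.
  case: j => // j _; have /eqP := pm' j.+1; rewrite addSn !psumS pm'.
  by rewrite (inj_eq (addrI _)) (inj_eq (addIr _)) => /eqP.
by rewrite -(pm k) -(Eh (k + m)%N) ?addn_gt0 ?m0 ?orbT // addnAC pm.
Qed.

Lemma floor_quasi_poly p r : (0 < p)%N ->
  exists2 A : {poly rat}, (size A <= r.+2)%N &
  exists2 psi, nmin_period psi p &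
    forall k, iter r psum (fun t => (t %/ p)%:R) k = A.[k%:R] + psi k.
Proof.
move=> p0; have pnz : p%:R != 0 :> rat by rewrite pnatr_eq0 -lt0n.
elim: r => [|r [A sA [psi mpsi hA]]].
  (* [floor(t/p) = t/p - (t mod p)/p]. The remainder vanishes at 0, hence at each of its periods, so
     [p] divides them. *)
  exists (p%:R^-1 *: 'X).
    by apply: leq_trans (size_scale_leq _ _) _; rewrite size_polyX.
  exists (fun k => - (p%:R^-1 * (k %% p)%:R)).
    split=> // [k|m m0 pm]; first by rewrite modnDr.
    have /= := pm 0%N; rewrite mod0n mulr0 oppr0 add0n => /eqP.
    rewrite oppr_eq0 mulf_eq0 invr_eq0 (negPf pnz) /= pnatr_eq0 => /dvdn_leq.
    exact.
  move=> k; rewrite hornerZ hornerX -mulrBr {2}(divn_eq k p).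
  by rewrite natrD addrK natrM mulrC mulfK.
have [A' sA' [psi' mpsi' hA']] := psum_quasi_poly A mpsi.
exists A'; first by apply: leq_trans sA' _; rewrite ltnS geq_max.
by exists psi' => // k; rewrite -hA'; apply: eq_psum.
Qed.

(** * Counting in a slice *)

(** The numerator is [p^2 ((p-1) a + b) + (p-1) d - p b], where [(p-1) d - p b] has absolute value
    below [p^2]. It is negative exactly when [d.-1 < b]; the truncated predecessor makes this right
    at [d = 0] too. *)
Lemma divn_slope_block p a b d : (b < p)%N -> (d < p)%N ->
  ((p.-1 * (p * (p * a + b) + d)) %/ (p * p) + (d.-1 < b) = p.-1 * a + b)%N.
Proof.
case: p => // p; rewrite /= ltnS => bp dp.
have key X e : (X * (p.+1 * p.+1) + e = p * (p.+1 * (p.+1 * a + b) + d) ->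
    e < p.+1 * p.+1 -> (p * (p.+1 * (p.+1 * a + b) + d)) %/ (p.+1 * p.+1) = X)%N.
  by move=> <- He; rewrite divnMDl // divn_small ?addn0.
case: (ltnP d.-1 b) => db.
  have [X HX] : exists X, (X + 1 = p * a + b)%N by exists (p * a + b - 1)%N; lia.
  have [e He] : exists e, (e + (p.+1 * b + d) = p.+1 * p.+1 + p.+1 * d)%N.
    by exists (p.+1 * p.+1 + p.+1 * d - (p.+1 * b + d))%N; nia.
  by rewrite (key X e) //; nia.
have [e He] : exists e, (e + (p.+1 * b + d) = p.+1 * d)%N.
  by exists (p.+1 * d - (p.+1 * b + d))%N; nia.
by rewrite addn0 (key (p * a + b)%N e) //; nia.
Qed.

Lemma sum_ltn_pred b p : (b < p)%N -> (\sum_(d < p) (d.-1 < b) = b + (0 < b))%N.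
Proof.
case: p => // p; rewrite ltnS big_ord_recl /= => bp.
have -> : (\sum_(i < p) (i < b) = b)%N.
  rewrite -(subnKC bp) big_split_ord /= (eq_bigr (fun=> 1%N)); last first.
    by move=> i _; rewrite ltn_ord.
  rewrite sum1_card card_ord big1 ?addn0 // => i _.
  by rewrite ltnNge leq_addr.
by rewrite addnC.
Qed.

(** Write [c = p a + b] with [b < p]. The block adds up to [p ((p-1) a + b)] minus the corrections
    [b + (0 < b)], which is [(p-1) c], less one unless [p] divides [c]. *)
Lemma sum_divn_slope_block p c : (0 < p)%N ->
  (\sum_(d < p) (p.-1 * (p * c + d)) %/ (p * p) + ~~ (p %| c) = p.-1 * c)%N.
Proof.
move=> p0; have [a [b [bp cE ->]]] : exists a b,
    [/\ (b < p)%N, c = (p * a + b)%N & ~~ (p %| c)%N = (0 < b)%N].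
  exists (c %/ p)%N, (c %% p)%N.
  by rewrite ltn_mod mulnC -divn_eq /dvdn -lt0n.
have : (\sum_(d < p) ((p.-1 * (p * c + d)) %/ (p * p) + (d.-1 < b)) =
        \sum_(d < p) (p.-1 * a + b))%N.
  by apply: eq_bigr => d _; rewrite cE divn_slope_block.
rewrite big_split /= sum_ltn_pred // sum_nat_const card_ord.
set B := (\sum_(d < p) _)%N; move: B => B; rewrite cE.
by case: p p0 {bp cE} => // p _ /=; nia.
Qed.

(** Among the blocks [0, ..., c-1], each one with index not divisible by [p] loses one; the
    [ceil(c/p)] others are counted by [(c + p.-1) %/ p]. *)
Lemma sum_divn_slope p c : (0 < p)%N ->
  (2 * (\sum_(i < c * p) (p.-1 * i) %/ (p * p) + c) =
   p.-1 * (c * c.-1) + 2 * ((c + p.-1) %/ p))%N.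
Proof.
move=> p0; elim: c => [|c IH].
  by rewrite mul0n big_ord0 add0n !muln0 divn_small ?ltn_predL.
rewrite [(c.+1 * p)%N]mulSn [(p + c * p)%N]addnC big_split_ord /=.
have := sum_divn_slope_block c p0.
set B := (\sum_(d < p) _)%N => HB.
have -> : (\sum_(i < p) (p.-1 * (c * p + i)) %/ (p * p) = B)%N.
  by apply: eq_bigr => i _; rewrite [(c * p)%N]mulnC.
have HC : ((c.+1 + p.-1) %/ p = (c + p.-1) %/ p + (p %| c))%N.
  by case: p p0 {IH HB B} => // p _; rewrite /= addSn divnS // [LHS]addnC -addnS dvdn_addl.
rewrite HC; move: B HB IH; set S := (\sum_(i < c * p) _)%N.
move: S (p %| c)%N => S e B HB IH {HC}.
by case: e HB; case: c IH => [|c] /= IH HB; nia.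
Qed.

(** Since [(p-1)^2 = p (p-2) + 1], the quotient is [t (p-2) + floor(t/p)]. It is the last term of
    the next sum and also gives [topz p t 0]. *)
Lemma divn_slope_end p t : (0 < p)%N ->
  ((p.-1 * (t * p * p.-1)) %/ (p * p) + t = t * p.-1 + t %/ p)%N.
Proof.
case: p => // p _ /=; rewrite mulnAC mulnA divnMr // addnC -divnMDl //.
have -> : (t * p.+1 + p * (t * p) = (t * p + t %/ p.+1) * p.+1 + t %% p.+1)%N.
  by rewrite mulnDl -addnA -divn_eq; nia.
by rewrite divnMDl // [((_ %% _) %/ _)%N]divn_small ?addn0 ?ltn_mod.
Qed.

Lemma sum_divn_slope_total p t : (0 < p)%N ->
  (2 * (\sum_(i < (t * p * p.-1).+1) (p.-1 * i) %/ (p * p)) =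
   p.-1 * ((t * p.-1) * (t * p.-1).-1))%N.
Proof.
move=> p0; have := sum_divn_slope (t * p.-1) p0.
rewrite [(t * p * p.-1)%N]mulnAC big_ord_recr /=.
case: p p0 => // p _ /=.
pose a := (t %/ p.+1)%N; pose b := (t %% p.+1)%N.
have tE : t = (a * p.+1 + b)%N by rewrite -divn_eq.
have bp : (b <= p)%N by rewrite -ltnS ltn_mod.
(* With [p] now the predecessor, this is [ceil(t p / (p+1)) = t - floor(t / (p+1))]; its floor
   cancels against the one in [E2]. *)
have E1 : ((t * p + p) %/ p.+1 + a = t)%N.
  have -> : (t * p + p = (a * p + b) * p.+1 + (p - b))%N.
    by have := subnKC bp; set e := (p - b)%N; nia.
  rewrite divnMDl // divn_small ?addn0; last by lia.
  by move: tE; rewrite mulnS; lia.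
have E2 : ((p * (t * p * p.+1)) %/ (p.+1 * p.+1) + t = t * p + a)%N.
  by rewrite -(@divn_slope_end p.+1 t) //= [(t * p * p.+1)%N]mulnAC.
move: E1 E2; clear tE bp; set S := (\sum_(i < _) _)%N.
move: S ((t * p + p) %/ p.+1)%N (p * (t * p * p.+1) %/ (p.+1 * p.+1))%N.
move: a (t * p)%N (p * (t * p * (t * p).-1))%N => {}a u v S x y.
lia.
Qed.

(** * Upper edges of a slice and the sum of its columns *)

Definition qn (p : nat) : nat := (p * p.-1).+1.

(* The largest y with |x| + y <= t q and p^2 y + (p - 1) |x| <= t p q, where
   m = |x|; the first bound is the active one from m = t (q - 1) on. *)
Definition topz (p t m : nat) : int :=
  Order.min ((t * qn p)%:Z - m%:Z)
            (((t * p * qn p)%:Z - (p.-1 * m)%:Z) %/ (p * p)%:Z)%Z.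

(** With [i = t p (p-1) - m], the first bound is [t + i] and the second is
    [t + floor((p-1) i / p^2)], hence the smaller. *)
Lemma topz_le p t m : (0 < p)%N -> (m <= t * p * p.-1)%N ->
  topz p t m = (t + (p.-1 * (t * p * p.-1 - m)) %/ (p * p))%:Z.
Proof.
move=> p0 hm; rewrite /topz.
have [i im] : exists i, (t * p * p.-1 = i + m)%N.
  by exists (t * p * p.-1 - m)%N; rewrite subnK.
rewrite im addnK.
have -> : (t * p * qn p)%:Z - (p.-1 * m)%:Z = t%:Z * (p * p)%:Z + (p.-1 * i)%:Z.
  have mE : m%:Z = (t * p * p.-1)%:Z - i%:Z by rewrite im PoszD addrC addKr.
  by rewrite !PoszM mE /qn; case: p p0 {im hm mE} => // p _ /=; ring.
rewrite divzMDl; last by nia.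
rewrite divz_nat -PoszD min_r //.
have : ((p.-1 * i) %/ (p * p) <= i)%N.
  have pp0 : (0 < p * p)%N by rewrite muln_gt0 p0.
  by rewrite -[leqRHS](mulnK i pp0) leq_div2r // mulnC leq_mul2l; nia.
by rewrite /qn; move: (_ %/ _)%N => d; nia.
Qed.

Lemma topz_ge p t m : (0 < p)%N -> (t * p * p.-1 <= m)%N ->
  topz p t m = (t * qn p)%:Z - m%:Z.
Proof.
move=> p0 hm; rewrite /topz min_l // lez_divRL; last by nia.
by rewrite /qn; case: p p0 hm => // p _ /=; nia.
Qed.

(** Keeps the column lengths below positive, so that [absz] does not change them. *)
Lemma topz_lb p k t m : (0 < p)%N -> (m <= k * qn p)%N ->
  0 <= topz p t m + (k * qn p)%:Z.
Proof.
move=> p0 hm; rewrite -lerBlDr sub0r /topz le_min; apply/andP; split; first by lia.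
rewrite lez_divRL; last by nia.
by move: (qn p) hm => q hm; case: p p0 => // p _ /=; nia.
Qed.

Lemma sum_topz p k t : (0 < p)%N -> (t <= k)%N ->
  let e := (k * qn p)%:Z - (t * p * p.-1)%:Z in
  2 * (\sum_(m < (k * qn p).+1) topz p t m) =
  2 * t%:Z * ((t * p * p.-1)%:Z + 1) +
  p.-1%:Z * ((t * p.-1)%:Z * ((t * p.-1)%:Z - 1)) + 2 * t%:Z * e - e * (e + 1).
Proof.
move=> p0 tk.
have [e kE] : exists e, (k * qn p = t * p * p.-1 + e)%N.
  by exists (k * qn p - t * p * p.-1)%N; rewrite subnKC // /qn; nia.
have := sum_divn_slope_total t p0.
set a := (t * p * p.-1)%N in kE *; set S := (\sum_(i < _) _)%N => HS.
(* The columns split after [m = t p (p-1)]: up to there, reversing the index gives the slope sum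
   [S]; beyond, the height falls by one per column. *)
have -> : \sum_(m < (k * qn p).+1) topz p t m =
    (a.+1 * t)%:Z + S%:Z + \sum_(i < e) (t%:Z - i.+1%:Z).
  rewrite kE -addSn big_split_ord /=; congr (_ + _).
    rewrite (eq_bigr (fun m : 'I_a.+1 => (t + (p.-1 * (a - m)) %/ (p * p))%:Z)).
      rewrite -(big_morph Posz PoszD (erefl _)) big_split /=.
      rewrite sum_nat_const card_ord PoszD; congr (_ + Posz _).
      rewrite (reindex_inj rev_ord_inj) /=; apply: eq_bigr => i _.
      by rewrite subSS subKn // -ltnS.
    by move=> m _; rewrite topz_le // -ltnS.
  apply: eq_bigr => i _; rewrite topz_ge //; last by lia.
  by rewrite /a /qn; nia.
have HT : 2 * (\sum_(i < e) (t%:Z - i.+1%:Z)) = 2 * t%:Z * e%:Z - e%:Z * (e%:Z + 1).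
  by elim: (e) => [|j IH]; rewrite ?big_ord0 ?mulr0 // big_ord_recr /= mulrDr IH; lia.
rewrite kE mulrDr HT mulrDr; move: HS; case: (t * p.-1)%N => [|z] /=; nia.
Qed.

Definition irange (a : int) (n : nat) : seq int := [seq a + i%:Z | i <- iota 0 n].

Lemma size_irange a n : size (irange a n) = n.
Proof. by rewrite size_map size_iota. Qed.

Lemma mem_irange a n x : (x \in irange a n) = (a <= x) && (x < a + n%:Z).
Proof.
apply/mapP/andP => [[i]|[h1 h2]].
  by rewrite mem_iota add0n => /andP[_ hi] ->; lia.
by exists `|x - a|%N; rewrite ?mem_iota; lia.
Qed.

Lemma irange_uniq a n : uniq (irange a n).
Proof. by rewrite map_inj_uniq ?iota_uniq // => i j /addrI []. Qed.

(** Each [m > 0] occurs with both signs, whereas doubling counts [m = 0] once too often. *)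
Lemma sum_irange_abs (F : nat -> int) b :
  \sum_(x <- irange (- b%:Z) (b + b).+1) F `|x|%N =
  2 * (\sum_(m < b.+1) F m) - F 0%N.
Proof.
rewrite big_map -[iota _ _]/(index_iota 0 (b + b).+1) -addnS.
rewrite (@big_cat_nat _ _ _ b) //=; last by lia.
rewrite mulrDl mul1r -addrA [RHS]addrC; congr (_ + _); last first.
  rewrite -{1}[b]add0n big_addn addKn big_mkord; apply: eq_bigr => i _.
  by congr F; lia.
rewrite big_ord_recl /= addrAC subrr add0r big_nat_rev big_mkord /=.
by apply: eq_bigr => i _; congr F; rewrite /bump; have := ltn_ord i; lia.
Qed.

(** The lower edge gives [floor(t/p)] in each of the [2 k q + 1] columns. Folding [x] onto [-x]
    subtracts [topz p t 0], which contains one [floor(t/p)], so [2 k q] of them remain. *)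
Lemma sum_slice p k t : (0 < p)%N -> (t <= k)%N ->
  let q := qn p in
  (\sum_(x <- irange (- (k * q)%:Z) (k * q + k * q).+1)
     absz (topz p t `|x| + (k * q)%:Z + (t %/ p)%:Z + 1)%R)%N%:Z =
  (2 * (k * q)%:Z + 1) * ((k * q)%:Z + 1) - (k * q)%:Z * ((k * q)%:Z + 1)
  + t%:Z * (2 + 2 * k%:Z * q%:Z ^+ 2)
  + t%:Z ^+ 2 * (2 * p%:Z * p.-1%:Z + p.-1%:Z ^+ 3 - 2 * q%:Z * p%:Z * p.-1%:Z
                 + p%:Z ^+ 2 * p.-1%:Z ^+ 2)
  + 2 * k%:Z * q%:Z * (t %/ p)%:Z.
Proof.
move=> p0 tk q; rewrite (big_morph Posz PoszD (erefl _)).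
pose F m := topz p t m + (k * q)%:Z + (t %/ p)%:Z + 1.
rewrite (eq_big_seq (fun x : int => F `|x|%N)); last first.
  move=> x; rewrite mem_irange => hx; rewrite gez0_abs //.
  rewrite addr_ge0 // addr_ge0 //; apply: topz_lb => //; rewrite -/q; lia.
rewrite sum_irange_abs /F !big_split /= !sumr_const card_ord.
have top0 : topz p t 0 = (t * p.-1 + t %/ p)%:Z.
  rewrite topz_le // subn0; congr Posz.
  by rewrite addnC divn_slope_end.
have := sum_topz p0 tk; rewrite -/q top0; set S := \sum_(i < _) _ => /=.
rewrite !mulrDr => ->.
rewrite /q /qn; case: p p0 {q F S top0} => // p _ /=.
move: (t %/ p.+1)%N => d; ring.
Qed.

(** * Summation over the simplex of the coordinates z *)

Fixpoint simplex_seq (r k : nat) : seq (seq nat) :=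
  if r is r'.+1 then
    [seq a :: z | a <- iota 0 k.+1, z <- simplex_seq r' (k - a)]
  else [:: [::]].

Lemma mem_simplex_seq r k z :
  (z \in simplex_seq r k) = (size z == r) && (sumn z <= k)%N.
Proof.
elim: r k z => [|r IH] k z.
  by rewrite inE /= size_eq0; case: z.
apply/allpairsPdep/andP => [[a [z' [+ + ->]]]|].
  by rewrite mem_iota IH /= eqSS => ha /andP[-> hz]; split=> //; lia.
case: z => [[]//|a z] [/= sz hz]; exists a, z.
have ha : a \in iota 0 k.+1 by rewrite mem_iota; lia.
by split=> //; rewrite IH -eqSS sz; lia.
Qed.

Lemma simplex_seq_uniq r k : uniq (simplex_seq r k).
Proof.
elim: r k => [|r IH] k; first by [].
apply: (@allpairs_uniq_dep _ _ _ (fun a z => a :: z) (iota 0 k.+1)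
  (fun a => simplex_seq r (k - a))) => [|a _|]; rewrite ?iota_uniq //.
by move=> [a z] [b y] _ _ /= [-> ->].
Qed.

(** A first entry [a] leaves a simplex of size [t = k - a] to the others, so every coordinate adds
    one partial sum. *)
Lemma sum_simplex_seq r k (f : nat -> rat) :
  \sum_(z <- simplex_seq r k) f (k - sumn z)%N = iter r psum f k.
Proof.
elim: r k => [|r IH] k; first by rewrite big_seq1 /= subn0.
transitivity (\sum_(a <- index_iota 0 k.+1)
    \sum_(z <- simplex_seq r (k - a)) f (k - sumn (a :: z))%N).
  exact: big_allpairs_dep.
rewrite big_nat_rev big_mkord iterS; apply: eq_bigr => t _.
rewrite add0n subSS -IH.
have -> : (k - (k - t) = t)%N by rewrite subKn // -ltnS.
apply: eq_bigr => z _ /=; congr f.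
by rewrite subnDA subKn // -ltnS.
Qed.

(** The column over [x] runs from [- k q - floor(t/p)] to [topz p t |x|]. *)
Definition slice_size (p k t : nat) : nat :=
  \sum_(x <- irange (- (k * qn p)%:Z) (k * qn p + k * qn p).+1)
     absz (topz p t `|x| + (k * qn p)%:Z + (t %/ p)%:Z + 1)%R.

(** Grouped by powers of [t], including the factor [1], to match the polynomials [1], ['X] and
    ['X^2] whose iterated sums are taken next. *)
Lemma slice_size_rat p k t : (0 < p)%N -> (t <= k)%N ->
  let q : rat := (qn p)%:R in
  (slice_size p k t)%:R =
  (q ^+ 2 * k%:R ^+ 2 + 2 * q * k%:R + 1) * 1
  + (2 + 2 * q ^+ 2 * k%:R) * t%:R
  + (2 * p%:R * p.-1%:R + p.-1%:R ^+ 3 - 2 * q * p%:R * p.-1%:R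
     + p%:R ^+ 2 * p.-1%:R ^+ 2) * t%:R ^+ 2
  + 2 * q * k%:R * (t %/ p)%:R.
Proof.
move=> p0 tk q; have := congr1 (intr : int -> rat) (sum_slice p0 tk).
rewrite -[X in Posz X]/(slice_size p k t) -pmulrn => ->.
rewrite /q; move: (qn p) (t %/ p)%N (p.-1) => {}q d p'; ring.
Qed.

Lemma slice_sum_quasi_poly p r : (0 < p)%N ->
  exists2 Q : {poly rat}, (size Q <= r.+3)%N &
  exists2 psi, nmin_period psi p &
  forall k, (\sum_(z <- simplex_seq r k) slice_size p k (k - sumn z))%N%:R =
    Q.[k%:R] + 2 * (qn p)%:R * k%:R * psi k.
Proof.
move=> p0; pose q : rat := (qn p)%:R.
have [A sA [psi mpsi hA]] := floor_quasi_poly r p0.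
have [S0 sS0 h0] := iter_psum_poly r 1.
have [S1 sS1 h1] := iter_psum_poly r 'X.
have [S2 sS2 h2] := iter_psum_poly r 'X^2.
rewrite size_poly1 in sS0; rewrite size_polyX in sS1; rewrite size_polyXn in sS2.
pose c : rat := 2 * p%:R * p.-1%:R + p.-1%:R ^+ 3 - 2 * q * p%:R * p.-1%:R
     + p%:R ^+ 2 * p.-1%:R ^+ 2.
(* The [Poly] factors are the coefficients of [1], [t] and [floor(t/p)] as polynomials in [k]; they
   stay constant while [t] is summed. *)
exists (Poly [:: 1; 2 * q; q ^+ 2] * S0 + Poly [:: 2; 2 * q ^+ 2] * S1 + c *: S2
        + Poly [:: 0; 2 * q] * A).
  have szM (s : seq rat) (P : {poly rat}) : (size P + size s <= r.+4)%N ->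
      (size (Poly s * P)%R <= r.+3)%N.
    move=> h; apply: leq_trans (size_polyMleq _ _) _.
    rewrite -subn1 leq_subLR add1n addnC; apply: leq_trans h.
    by rewrite leq_add2l; apply: size_Poly.
  do 3?[apply: leq_trans (size_polyD _ _) _; rewrite geq_max; apply/andP; split].
  - by apply: szM; apply: leq_trans (leq_add sS0 (leqnn _)) _; rewrite addnAC.
  - by apply: szM; apply: leq_trans (leq_add sS1 (leqnn _)) _; rewrite addnAC.
  - by apply: leq_trans (size_scale_leq _ _) sS2.
  - by apply: szM; apply: leq_trans (leq_add sA (leqnn _)) _; rewrite addn2.
exists psi => // k; rewrite natr_sum.
pose f t : rat := (q ^+ 2 * k%:R ^+ 2 + 2 * q * k%:R + 1) * (1 : {poly rat}).[t%:R]
  + (2 + 2 * q ^+ 2 * k%:R) * 'X.[t%:R] + c * 'X^2.[t%:R]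
  + 2 * q * k%:R * (t %/ p)%:R.
rewrite (eq_big_seq (fun z => f (k - sumn z)%N)); last first.
  move=> z _; rewrite slice_size_rat ?leq_subr // /f.
  by rewrite hornerC hornerX hornerXn.
rewrite sum_simplex_seq /f !iter_psumD !iter_psumZ h0 h1 h2 hA.
rewrite !hornerD !hornerM hornerZ !horner_Poly /= -/q; ring.
Qed.

(** Reading residues modulo [m] extends the sequence to all integers; a shift and a nonzero factor
    preserve the minimum period. *)
Lemma int_min_period f m : nmin_period f m ->
  forall a b : rat, b != 0 ->
  min_period (fun k : int => a + b * f `|(k %% m)%Z|%N) m.
Proof.
case=> m0 fm minm a b b0; split=> // [k|m' m'0 pm']; first by rewrite modzDr.
apply: minm => // k; have := pm' k%:Z.
rewrite -PoszD !modz_nat !absz_nat !nperiodic_modn //.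
by move/addrI/(mulfI b0).
Qed.

Lemma min_period_const (a : rat) : min_period (fun=> a) 1.
Proof. by split. Qed.

(** * Half-space description of H_n *)

Section Coordinates.
Variables (F : Type) (r : nat).
Implicit Types v : 'rV[F]_r.+2.

Definition vx v : F := v 0 ord0.
Definition vy v : F := v 0 (lift ord0 ord0).
Definition vz v (i : 'I_r) : F := v 0 (lift ord0 (lift ord0 i)).

Definition mkv (a b : F) (z : 'I_r -> F) : 'rV[F]_r.+2 :=
  \row_j (if unlift ord0 j is Some j1 then
            if unlift ord0 j1 is Some i then z i else b
          else a).

Lemma vx_mkv a b z : vx (mkv a b z) = a.
Proof. by rewrite /vx mxE unlift_none. Qed.

Lemma vy_mkv a b z : vy (mkv a b z) = b.
Proof. by rewrite /vy mxE liftK unlift_none. Qed.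

Lemma vz_mkv a b z i : vz (mkv a b z) i = z i.
Proof. by rewrite /vz mxE !liftK. Qed.

Lemma eq_coords v v' :
  vx v = vx v' -> vy v = vy v' -> vz v =1 vz v' -> v = v'.
Proof.
move=> ex ey ez; apply/rowP => j.
have [j1 ->|->] := unliftP ord0 j; last exact: ex.
by have [i ->|->] := unliftP ord0 j1; [apply: ez|apply: ey].
Qed.

End Coordinates.

Lemma map_mkv (F F' : Type) (f : F -> F') r (a b : F) (z : 'I_r -> F) :
  map_mx f (mkv a b z) = mkv (f a) (f b) (f \o z).
Proof. by apply: eq_coords => [||i]; rewrite ?(vx_mkv, vy_mkv, vz_mkv) [LHS]mxE;
  rewrite -?/(vx _) -?/(vy _) -?/(vz _ _) ?(vx_mkv, vy_mkv, vz_mkv). Qed.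

(** * Convex combinations *)

Section Convex.
Variables (R : realType) (n : nat).
Implicit Types A C : set 'rV[R]_n.

Lemma convex_setP C : @convex_set R 'rV[R]_n C <->
  forall x y (t : R), 0 <= t -> t <= 1 -> C x -> C y ->
    C (t *: x + (1 - t) *: y).
Proof.
split=> [cC x y t t0 t1 Cx Cy|cC x y l]; last first.
  by rewrite !inE => Cx Cy; apply: (cC x y l%:num) => //; apply: le1.
have := cC x y (Itv01 t0 t1); rewrite !inE; exact.
Qed.

Lemma convex_conv A : @convex_set R 'rV[R]_n (conv A).
Proof.
apply/convex_setP => x y t t0 t1 Ax Ay C [/[dup] cC /convex_setP cC' AC].
by apply: cC' => //; [apply: Ax|apply: Ay].
Qed.

Lemma sub_conv A : A `<=` conv A.
Proof. exact: sub_gen_smallest. Qed.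

Lemma conv_sub A C : @convex_set R 'rV[R]_n C -> A `<=` C -> conv A `<=` C.
Proof. exact: smallest_sub. Qed.

Lemma convex_sum C m (w : 'I_m -> R) (c : 'I_m -> 'rV[R]_n) :
  @convex_set R 'rV[R]_n C -> (forall i, 0 <= w i) -> \sum_i w i = 1 ->
  (forall i, C (c i)) -> C (\sum_i w i *: c i).
Proof.
move=> /convex_setP cC; elim: m w c => [|m IH] w c w0.
  by rewrite big_ord0 => /eqP; rewrite eq_sym oner_eq0.
rewrite !big_ord_recl => w1 Cc.
have s0 : 0 <= \sum_(i < m) w (lift ord0 i) by apply: sumr_ge0.
have sE : \sum_(i < m) w (lift ord0 i) = 1 - w ord0 by rewrite -w1 addrC addKr.
(* The remaining weights are normalised by their sum, so the case where they all vanish is treated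
   apart. *)
have [s_eq0|s_neq0] := eqVneq (\sum_(i < m) w (lift ord0 i)) 0.
  rewrite [X in _ + X]big1 ?addr0 => [|i _].
    by move: w1; rewrite s_eq0 addr0 => ->; rewrite scale1r.
  by move/psumr_eq0P: s_eq0 => -> //; rewrite scale0r.
rewrite sE in s0 s_neq0.
have -> : \sum_(i < m) w (lift ord0 i) *: c (lift ord0 i) =
    (1 - w ord0) *: \sum_(i < m) (w (lift ord0 i) / (1 - w ord0)) *: c (lift ord0 i).
  rewrite scaler_sumr; apply: eq_bigr => i _.
  by rewrite scalerA mulrCA divff // mulr1.
apply: cC => //; first by rewrite -subr_ge0.
apply: (IH (fun i => w (lift ord0 i) / (1 - w ord0))) => // [i|].
  by rewrite divr_ge0.
by rewrite -mulr_suml sE divff.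
Qed.

End Convex.

Lemma between (R : realFieldType) (a b x : R) : a <= x -> x <= b ->
  exists l, [/\ 0 <= l, l <= 1 & x = l * a + (1 - l) * b].
Proof.
move=> ax xb; have [ab|ab] := eqVneq a b.
  by exists 1; split=> //; rewrite subrr mul0r addr0 mul1r; apply/le_anti; rewrite ax ab xb.
have lt_ab : 0 < b - a by rewrite subr_gt0 lt_neqAle ab (le_trans ax).
exists ((b - x) / (b - a)); split.
- by rewrite divr_ge0 ?subr_ge0 // ltW // -subr_gt0.
- by rewrite ler_pdivrMr // mul1r lerD2l lerN2.
- by field; rewrite gt_eqF.
Qed.

(** * The polytope cut out by the inequalities and its vertices *)

Section VertexLists.
Variables (F : fieldType) (p : F).
Let q : F := p ^+ 2 - p + 1.

(* The (x, y) for which (x, y, 0) is a vertex of H_n. *)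
Definition base_vertices : seq (F * F) :=
  [:: (q, - q - p^-1); (- q, - q - p^-1); (q, 0); (- q, 0); (q - 1, 1);
      (- (q - 1), 1); (0, q / p)].

(* The (x, y) for which each (x, y, e_i) is a vertex of H_n. *)
Definition top_vertices : seq (F * F) := [:: (q, - q); (- q, - q); (0, 0)].

End VertexLists.

Section HalfSpaces.
Variables (R : realType) (r : nat) (p : R).
Let q : R := p ^+ 2 - p + 1.

Definition vs (v : 'rV[R]_r.+2) : R := \sum_i vz v i.

Definition Hpoly : set 'rV[R]_r.+2 := [set v |
  [/\ (forall i, 0 <= vz v i) /\ vs v <= 1, `|vx v| <= q,
      - (p * q) - (1 - vs v) <= p * vy v,
      `|vx v| + vy v <= (1 - vs v) * q
    & p ^+ 2 * vy v + (p - 1) * `|vx v| <= (1 - vs v) * (p * q)]].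

Hypothesis p1 : 1 <= p.

Lemma vx_comb a b (v w : 'rV[R]_r.+2) : vx (a *: v + b *: w) = a * vx v + b * vx w.
Proof. by rewrite /vx !mxE. Qed.

Lemma vy_comb a b (v w : 'rV[R]_r.+2) : vy (a *: v + b *: w) = a * vy v + b * vy w.
Proof. by rewrite /vy !mxE. Qed.

Lemma vz_comb a b (v w : 'rV[R]_r.+2) i :
  vz (a *: v + b *: w) i = a * vz v i + b * vz w i.
Proof. by rewrite /vz !mxE. Qed.

Lemma vs_comb a b (v w : 'rV[R]_r.+2) : vs (a *: v + b *: w) = a * vs v + b * vs w.
Proof.
rewrite /vs !mulr_sumr -big_split; apply: eq_bigr => i _; exact: vz_comb.
Qed.

Lemma convex_Hpoly : @convex_set R 'rV[R]_r.+2 Hpoly.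
Proof.
apply/convex_setP => v w t t0 t1 [[v0 v1] v2 v3 v4 v5] [[w0 w1] w2 w3 w4 w5].
have u0 : 0 <= 1 - t by rewrite subr_ge0.
have comb (a b a' b' : R) : a <= b -> a' <= b' ->
    t * a + (1 - t) * a' <= t * b + (1 - t) * b'.
  by move=> ab ab'; rewrite lerD // ler_wpM2l.
have hn : `|t * vx v + (1 - t) * vx w| <= t * `|vx v| + (1 - t) * `|vx w|.
  by apply: le_trans (ler_normD _ _) _; rewrite !normrM (ger0_norm t0) (ger0_norm u0).
(* In the last bound [|x|] has coefficient [p - 1]; its sign lets the triangle inequality be used
   there. *)
have p0 : 0 <= p - 1 by rewrite subr_ge0.
have hn' := ler_wpM2l p0 hn.
rewrite /Hpoly /= vx_comb vy_comb vs_comb; split.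
- split=> [i|]; first by rewrite vz_comb addr_ge0 // mulr_ge0.
  by have := comb _ _ _ _ v1 w1; lra.
- by have := comb _ _ _ _ v2 w2; lra.
- by have := comb _ _ _ _ v3 w3; lra.
- by have := comb _ _ _ _ v4 w4; lra.
- by have := comb _ _ _ _ v5 w5; lra.
Qed.

(** In the right half of a slice, [(x, y)] lies on a vertical segment from the bottom edge, at
    height [lo], to the roof through [(0, w)], [(t (q-1), t)] and [(q, t q - q)]. Hence a convex [D]
    with these points and the two bottom corners contains it. *)
Lemma half_slice (D : R -> R -> Prop) (t w lo x y : R) :
  (forall x1 y1 x2 y2 l, 0 <= l -> l <= 1 -> D x1 y1 -> D x2 y2 ->
     D (l * x1 + (1 - l) * x2) (l * y1 + (1 - l) * y2)) ->
  0 <= t -> p * w = t * q -> p * lo = - (p * q) - t ->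
  D q lo -> D (- q) lo -> D 0 w -> D (t * (q - 1)) t -> D q (t * q - q) ->
  0 <= x -> x <= q -> lo <= y -> x + y <= t * q ->
  p ^+ 2 * y + (p - 1) * x <= t * (p * q) -> D x y.
Proof.
move=> cD t0 wE loE D1 D2 D3 D4 D5 x0 xq ylo yx yp.
have p_gt0 : 0 < p := lt_le_trans ltr01 p1.
have Dlo : D x lo.
  have [l [l0 l1 xE]] : exists l, [/\ 0 <= l, l <= 1 & x = l * - q + (1 - l) * q].
    by apply: between => //; rewrite (le_trans _ x0) // oppr_le0 (le_trans x0).
  have -> : lo = l * lo + (1 - l) * lo by ring.
  by rewrite xE; apply: cD.
(* [u] is the height of the roof over [x], on the edge left or right of [t (q - 1)]. *)
have [u Du yu] : exists2 u, D x u & y <= u.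
  have [xt|/ltW xt] := leP x (t * (q - 1)).
    have [l [l0 l1 xE]] := between x0 xt.
    exists (l * w + (1 - l) * t); first by rewrite xE; apply: cD.
    have p2 : 0 < p ^+ 2 by rewrite exprn_gt0.
    rewrite -(ler_pM2l p2); apply: le_trans (_ : t * (p * q) - (p - 1) * x <= _).
      by rewrite lerBrDr.
    have -> : p ^+ 2 * (l * w + (1 - l) * t) =
      p * l * (p * w) + p ^+ 2 * ((1 - l) * t) by ring.
    by rewrite wE xE /q le_eqVlt; apply/orP; left; apply/eqP; ring.
  have [l [l0 l1 xE]] := between xt xq.
  exists (l * t + (1 - l) * (t * q - q)); first by rewrite xE; apply: cD.
  by rewrite -(lerD2l x); apply: le_trans yx _; rewrite xE; lra.
have [l [l0 l1 yE]] := between ylo yu.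
have -> : x = l * x + (1 - l) * x by ring.
by rewrite yE; apply: cD.
Qed.

(** The slice through [v] with [z] fixed is spanned by points [(1 - s) b + s c], with [b] a base
    vertex and [c] a top vertex. These lie in [C], and [half_slice] fills in the rest. *)
Lemma Hpoly_sub (C : set 'rV[R]_r.+2) : @convex_set R 'rV[R]_r.+2 C ->
  (forall c, c \in base_vertices p -> C (mkv c.1 c.2 (fun=> 0))) ->
  (forall c i, c \in top_vertices p -> C (mkv c.1 c.2 (fun j => (i == j)%:R))) ->
  Hpoly `<=` C.
Proof.
move=> cC hB hT v [[v0 v1] v2 v3 v4 v5].
have p_gt0 : 0 < p := lt_le_trans ltr01 p1.
pose D x y := C (mkv x y (vz v)).
have cD x1 y1 x2 y2 l : 0 <= l -> l <= 1 -> D x1 y1 -> D x2 y2 ->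
    D (l * x1 + (1 - l) * x2) (l * y1 + (1 - l) * y2).
  move=> l0 l1 d1 d2; have := (convex_setP C).1 cC _ _ _ l0 l1 d1 d2.
  rewrite /D; congr C; apply: eq_coords => [||i].
  - by rewrite vx_comb !vx_mkv.
  - by rewrite vy_comb !vy_mkv.
  - by rewrite vz_comb !vz_mkv -mulrDl addrCA subrr addr0 mul1r.
pose s := vs v.
have join b c : b \in base_vertices p -> c \in top_vertices p ->
    D ((1 - s) * b.1 + s * c.1) ((1 - s) * b.2 + s * c.2).
  move=> hb hc.
  (* Weight [1 - s] on [b] and [z_i] on the copy of [c] over [e_i] reproduce the coordinates [z] of
     [v]. *)
  have := @convex_sum R _ C r.+1
    (fun j => if unlift ord0 j is Some i then vz v i else 1 - s)
    (fun j => if unlift ord0 j is Some i then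
       mkv c.1 c.2 (fun j => (i == j)%:R) else mkv b.1 b.2 (fun=> 0)) cC.
  rewrite !big_ord_recl !unlift_none.
  under eq_bigr do rewrite liftK.
  under [X in _ -> _ -> _ -> C (_ + X)]eq_bigr do rewrite liftK.
  move=> H; rewrite /D; apply: (eq_ind _ C (H _ _ _)).
  - by move=> j; case: unliftP => [i _|_]; rewrite ?subr_ge0.
  - by rewrite -/(vs v) subrK.
  - by move=> j; case: unliftP => [i _|_]; [apply: hT|apply: hB].
  apply: eq_coords => [||i]; rewrite ?(vx_mkv, vy_mkv, vz_mkv).
  - rewrite /vx mxE summxE [X in X + _]mxE -/(vx _) vx_mkv; congr (_ + _).
    by rewrite mulr_suml; apply: eq_bigr => i _; rewrite mxE -/(vx _) vx_mkv.
  - rewrite /vy mxE summxE [X in X + _]mxE -/(vy _) vy_mkv; congr (_ + _).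
    by rewrite mulr_suml; apply: eq_bigr => i _; rewrite mxE -/(vy _) vy_mkv.
  - rewrite [LHS]/vz mxE summxE [X in X + _]mxE -/(vz (mkv _ _ _) _) vz_mkv mulr0 add0r.
    rewrite (bigD1 i) //= mxE -/(vz (mkv _ _ _) _) vz_mkv eqxx mulr1 big1 ?addr0 // => j ji.
    by rewrite mxE -/(vz (mkv _ _ _) _) vz_mkv (negPf ji) mulr0.
have -> : v = mkv (vx v) (vy v) (vz v).
  by apply: eq_coords => [||i]; rewrite ?(vx_mkv, vy_mkv, vz_mkv).
have Dat b c x y : b \in base_vertices p -> c \in top_vertices p ->
    x = (1 - s) * b.1 + s * c.1 -> y = (1 - s) * b.2 + s * c.2 -> D x y.
  by move=> hb hc -> ->; apply: join.
have pV : p * p^-1 = 1 by rewrite divff // gt_eqF.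
pose t := 1 - s; pose lo := - q - t / p; pose w := t * q / p.
have t0 : 0 <= t by rewrite subr_ge0.
have wE : p * w = t * q by rewrite /w mulrCA pV mulr1.
have loE : p * lo = - (p * q) - t by rewrite /lo mulrBr mulrCA pV; ring.
have inB i : (i < 7)%N -> nth (0, 0) (base_vertices p) i \in base_vertices p.
  by move=> hi; apply: mem_nth.
have inT i : (i < 3)%N -> nth (0, 0) (top_vertices p) i \in top_vertices p.
  by move=> hi; apply: mem_nth.
have ylo : lo <= vy v by rewrite -(ler_pM2l p_gt0) loE.
have d0 : D q lo.
  by apply: (Dat _ _ _ _ (inB 0%N isT) (inT 0%N isT)) => /=; rewrite /lo /t /q; ring.
have d1 : D (- q) lo.
  by apply: (Dat _ _ _ _ (inB 1%N isT) (inT 1%N isT)) => /=; rewrite /lo /t /q; ring.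
have d2 : D q (t * q - q).
  by apply: (Dat _ _ _ _ (inB 2%N isT) (inT 0%N isT)) => /=; rewrite /t /q; ring.
have d3 : D (- q) (t * q - q).
  by apply: (Dat _ _ _ _ (inB 3%N isT) (inT 1%N isT)) => /=; rewrite /t /q; ring.
have d4 : D (t * (q - 1)) t.
  by apply: (Dat _ _ _ _ (inB 4%N isT) (inT 2%N isT)) => /=; rewrite /t /q; ring.
have d5 : D (- (t * (q - 1))) t.
  by apply: (Dat _ _ _ _ (inB 5%N isT) (inT 2%N isT)) => /=; rewrite /t /q; ring.
have d6 : D 0 w.
  by apply: (Dat _ _ _ _ (inB 6%N isT) (inT 2%N isT)) => /=; rewrite /w /t /q; ring.
have [x0|/ltW x0] := leP 0 (vx v).
  rewrite ger0_norm // in v2 v4 v5.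
  by apply: (@half_slice D t w lo).
rewrite ler0_norm // in v2 v4 v5.
(* The left half is the mirror image of the right one. *)
have := @half_slice (fun x y => D (- x) y) t w lo (- vx v) (vy v).
rewrite opprK oppr0 opprK; apply=> //; last by rewrite oppr_ge0.
move=> x1 y1 x2 y2 l l0 l1 h1 h2; have := cD _ _ _ _ l l0 l1 h1 h2.
by congr D; ring.
Qed.

End HalfSpaces.

Section Vertices.
Variables (R : realType) (r : nat) (p : R).
Hypothesis p1 : 1 <= p.
Let q : R := p ^+ 2 - p + 1.

Lemma q_ge1 : 1 <= q.
Proof. by have := p1; rewrite /q; nra. Qed.

Lemma vs_mkv a b (z : 'I_r -> R) : vs (mkv a b z) = \sum_i z i.
Proof. by apply: eq_bigr => i _; rewrite vz_mkv. Qed.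

Lemma Hpoly_vertex_base c :
  c \in base_vertices p -> Hpoly p (mkv c.1 c.2 (fun _ : 'I_r => 0)).
Proof.
(* Facts about products of [p], [1/p] and [q] are prepared here; the inequalities that remain are
   linear in these products. *)
have h1 := p1; have q1 := q_ge1; have p0 : 0 < p := lt_le_trans ltr01 p1.
have pV : p * p^-1 = 1 by rewrite divff // gt_eqF.
have V0 : 0 < p^-1 by rewrite invr_gt0.
have V1 : p^-1 <= 1 by rewrite invf_le1.
have pq0 : 0 < p * q by rewrite mulr_gt0 // (lt_le_trans ltr01 q1).
have qp : p * (q / p) = q by rewrite mulrCA pV mulr1.
have p2V : p ^+ 2 / p = p by rewrite expr2 -mulrA pV mulr1.
have p2qV : p ^+ 2 * (q / p) = p * q by rewrite expr2 -mulrA qp.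
have p2q : 0 <= p ^+ 2 * q by rewrite mulr_ge0 ?exprn_ge0 ?(le_trans ler01 q1) // ltW.
have qV : q / p <= q by rewrite ler_piMr // (le_trans ler01 q1).
have qE : q = p ^+ 2 - p + 1 by [].
move=> hc; rewrite /Hpoly /= vs_mkv vx_mkv vy_mkv big1 // subr0.
split; first by split=> // i; rewrite vz_mkv.
all: move: hc; rewrite !inE -/q.
all: do ?[case/orP]; move/eqP => -> /=; rewrite ?normrN ?normr0.
all: rewrite ?(ger0_norm (le_trans ler01 q1)).
all: rewrite ?(@ger0_norm _ (q - 1)) ?subr_ge0 //.
all: rewrite ?mulrBr ?mulr0 ?addr0 ?mul1r ?mulr1.
all: by rewrite ?qp ?p2V ?p2qV; lra.
Qed.

Lemma Hpoly_vertex_top c i : c \in top_vertices p ->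
  Hpoly p (mkv c.1 c.2 (fun j : 'I_r => (i == j)%:R)).
Proof.
have h1 := p1; have q1 := q_ge1; have p0 : 0 < p := lt_le_trans ltr01 p1.
have q0 : 0 <= q := le_trans ler01 q1.
have pq0 : 0 <= p * q by rewrite mulr_ge0 // ltW.
have p2q : 0 <= p ^+ 2 * q - (p - 1) * q.
  by rewrite -mulrBl mulr_ge0 //; nra.
move=> hc; rewrite /Hpoly /= vs_mkv vx_mkv vy_mkv.
have -> : \sum_(j < r) (i == j)%:R = 1 :> R.
  by rewrite (bigD1 i) //= eqxx big1 ?addr0 // => j; rewrite eq_sym => /negPf ->.
rewrite subrr !mul0r subr0.
split; first by split=> // j; rewrite vz_mkv ler0n.
all: move: hc; rewrite !inE -/q.
all: do ?[case/orP]; move/eqP => -> /=; rewrite ?normrN ?normr0 ?(ger0_norm q0).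
all: rewrite ?mulrN ?mulr0 ?addr0 //; lra.
Qed.

End Vertices.

(** * Equality of H_n with the polytope of the inequalities *)

Section HnHalfSpaces.
Variables (R : realType) (r p : nat).
Hypothesis p0 : (0 < p)%N.
Notation n := r.+2.
Notation pR := (p%:R : R).
Notation q := (qp R p).

Let p1 : 1 <= pR. Proof. by rewrite ler1n. Qed.

Lemma vx_bvec i : vx (bvec R n i) = (1%N == i)%:R.
Proof. by rewrite /vx mxE. Qed.

Lemma vy_bvec i : vy (bvec R n i) = (2%N == i)%:R.
Proof. by rewrite /vy mxE. Qed.

Lemma vz_bvec i j : vz (bvec R n i) j = (j.+3 == i)%:R.
Proof. by rewrite /vz mxE. Qed.

Lemma coordE m (x : 'rV[R]_m) (j : 'I_m) : coord x j = x 0 j.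
Proof. by rewrite /coord valK. Qed.

Lemma coord_out m (x : 'rV[R]_m) j : (m <= j)%N -> coord x j = 0.
Proof. by move=> mj; rewrite /coord insubF // ltnNge mj. Qed.

Lemma pad_mkv (x : 'rV[R]_2) : pad n x = mkv (x 0 0) (x 0 1) (fun=> 0).
Proof.
apply: eq_coords => [||i]; rewrite ?(vx_mkv, vy_mkv, vz_mkv).
- by rewrite /vx mxE -(coordE x 0).
- by rewrite /vy mxE -(coordE x 1).
- by rewrite /vz mxE coord_out.
Qed.

(** The pentagon's vertices are the entries 2 to 6 of [base_vertices], and the preimage of [Hpoly]
    under [pad] is convex. *)
Lemma pentagon_emb_sub_Hpoly : @pentagon_emb R p n `<=` Hpoly (r := r) pR.
Proof.
move=> _ [x + <-].
have : @convex_set R 'rV[R]_2 [set x | Hpoly (r := r) pR (pad n x)].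
  apply/convex_setP => u v t t0 t1 /= hu hv.
  have := (convex_setP _).1 (convex_Hpoly (r := r) p1) _ _ _ t0 t1 hu hv.
  rewrite !pad_mkv; congr Hpoly; apply: eq_coords => [||i].
  - by rewrite vx_comb !vx_mkv !mxE.
  - by rewrite vy_comb !vy_mkv !mxE.
  - by rewrite vz_comb !vz_mkv !mulr0 addr0.
move/conv_sub; apply => {}x /=.
have key c : c \in base_vertices pR -> x 0 0 = c.1 -> x 0 1 = c.2 ->
    Hpoly (r := r) pR (pad n x).
  by move=> hc e1 e2; rewrite pad_mkv e1 e2; apply: Hpoly_vertex_base.
have inB i : (i < 7)%N -> nth (0, 0) (base_vertices pR) i \in base_vertices pR.
  by move=> hi; apply: mem_nth.
rewrite !inE => /orP[|/orP[|/orP[|/orP[|]]]] /eqP xE.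
- by apply: (key _ (inB 2%N isT)); rewrite xE !mxE /= -/(qp R p); ring.
- by apply: (key _ (inB 3%N isT)); rewrite xE !mxE /= -/(qp R p); ring.
- by apply: (key _ (inB 4%N isT)); rewrite xE !mxE /= -/(qp R p); ring.
- by apply: (key _ (inB 5%N isT)); rewrite xE !mxE /= -/(qp R p); ring.
- by apply: (key _ (inB 6%N isT)); rewrite xE !mxE /= -/(qp R p); ring.
Qed.

Lemma bvec_mkv (i : 'I_r) : bvec R n i.+3 = mkv 0 0 (fun j => (i == j)%:R).
Proof.
apply: eq_coords => [||j]; rewrite ?(vx_mkv, vy_mkv, vz_mkv).
- by rewrite vx_bvec.
- by rewrite vy_bvec.
- by rewrite vz_bvec !eqSS eq_sym.
Qed.

Lemma Pn_sub_Hpoly : @Pn R p n `<=` Hpoly (r := r) pR.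
Proof.
apply: conv_sub; first exact: convex_Hpoly.
move=> x [/pentagon_emb_sub_Hpoly//|[i /= /andP[i3 ir] <-]].
have lt_i : (i - 3 < r)%N by lia.
have -> : i = (Ordinal lt_i).+3 by rewrite /=; lia.
rewrite bvec_mkv; apply: (@Hpoly_vertex_top R r pR p1 (0, 0)).
by rewrite !inE eqxx !orbT.
Qed.

Lemma Sn_sub : @Sn R p n `<=` [set u | [/\ u 0 ord0 <= 0,
  forall i : 'I_r, 0 <= u 0 (lift ord0 i) &
  \sum_(i < r) u 0 (lift ord0 i) <= 1 + pR * u 0 ord0]].
Proof.
apply: conv_sub.
  apply/convex_setP => u v t t0 t1 /= [u1 u2 u3] [v1 v2 v3].
  have t0' : 0 <= 1 - t by rewrite subr_ge0.
  split.
  - by rewrite !mxE; nra.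
  - by move=> i; rewrite !mxE addr_ge0 // mulr_ge0.
  - rewrite (eq_bigr (fun i => t * u 0 (lift ord0 i) + (1 - t) * v 0 (lift ord0 i))).
      rewrite big_split /= -!mulr_sumr !mxE.
      by have := ler_wpM2l t0 u3; have := ler_wpM2l t0' v3; lra.
    by move=> i _; rewrite !mxE.
have pV : pR * pR^-1 = 1 by rewrite divff // pnatr_eq0 -lt0n.
move=> u [[->|->]|[i /= /andP[i2 ir] <-]].
- by split=> [|i|]; rewrite ?big1 ?mxE //= => *; rewrite ?mxE // mulr0 addr0.
- split=> [|i|].
  + by rewrite !mxE /= mulr1 oppr_le0 invr_ge0 ler0n.
  + by rewrite !mxE /= mulr0 oppr0.
  + rewrite big1 => [|i _]; last by rewrite !mxE /= mulr0 oppr0.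
    by rewrite !mxE /= mulr1 mulrN pV subrr.
have lt_i : (i - 2 < r)%N by lia.
have -> : i = (Ordinal lt_i).+2 by rewrite /=; lia.
split=> [|j|]; rewrite ?mxE ?ler0n //=.
rewrite (bigD1 (Ordinal lt_i)) //= big1 => [|j ji].
  by rewrite mxE eqxx addr0 mulr0 addr0.
by rewrite mxE /= !eqSS -[(_ - _)%N]/(val (Ordinal lt_i)) (inj_eq val_inj) (negPf ji).
Qed.

(** The first coordinate of [Sn] is [y + q]. So [s <= 1 + p (y + q)], which is the lower bound on
    [y]; and [y <= -q] with [|x| <= q] makes the left sides of both upper bounds nonpositive. *)
Lemma Wn_sub_Hpoly : @Wn R p n `<=` Hpoly (r := r) pR.
Proof.
have q1 : 1 <= q := q_ge1 p1.
move=> _ [c [c0 /Sn_sub /= [u1 u2 u3]] <-].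
have cx : coord c 0 = vx c by rewrite /vx -(coordE c ord0).
have cy : coord c 1 = vy c by rewrite /vy -(coordE c (lift ord0 ord0)).
have cz (i : 'I_r) : coord c i.+2 = vz c i.
  by rewrite /vz -(coordE c (lift ord0 (lift ord0 i))).
rewrite cx in c0.
have {}u1 : vy c <= 0 by move: u1; rewrite mxE cy.
have {}u2 i : 0 <= vz c i by have := u2 i; rewrite mxE cz.
have {}u3 : vs c <= 1 + pR * vy c.
  move: u3; rewrite mxE cy (eq_bigr (vz c)) // => i _.
  by rewrite mxE cz.
have s0 : 0 <= vs c by apply: sumr_ge0.
have -> : c - q *: bvec R n 2 = mkv (vx c) (vy c - q) (vz c).
  apply: eq_coords => [||i]; rewrite ?(vx_mkv, vy_mkv, vz_mkv).
  - by rewrite /vx !mxE /= mulr0 subr0.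
  - by rewrite /vy !mxE /= mulr1.
  - by rewrite /vz !mxE /= mulr0 subr0.
have c0' : `|vx c| <= q by rewrite ler_norml; move: c0; rewrite /= in_itv.
have p1' := p1.
have py : pR * vy c <= 0 by rewrite mulr_ge0_le0 // (le_trans ler01).
have s1 : vs c <= 1 by lra.
have sq : 0 <= (1 - vs c) * q by rewrite mulr_ge0 ?subr_ge0 // (le_trans ler01).
have spq : 0 <= (1 - vs c) * (pR * q).
  by rewrite mulr_ge0 ?subr_ge0 // mulr_ge0 // (le_trans ler01).
rewrite /Hpoly /= vs_mkv vx_mkv vy_mkv -/(vs c) -/(qp R p); split=> //.
- by split=> // i; rewrite vz_mkv.
- by lra.
- by lra.
have h1 : (pR - 1) * `|vx c| <= (pR - 1) * q by rewrite ler_wpM2l // subr_ge0.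
have h2 : 0 <= (pR ^+ 2 - (pR - 1)) * q.
  by rewrite mulr_ge0 ?(le_trans ler01) //; nra.
have h3 : pR ^+ 2 * vy c <= 0 by rewrite mulr_ge0_le0 // exprn_ge0 // (le_trans ler01).
by lra.
Qed.

Lemma Hn_sub_Hpoly : @Hn R p n `<=` Hpoly (r := r) pR.
Proof.
apply: conv_sub; first exact: convex_Hpoly.
by move=> x [/Wn_sub_Hpoly|/Pn_sub_Hpoly].
Qed.

Lemma cylinder_Wn (a b : R) (z : 'I_r -> R) : `|a| <= q ->
  Sn p (\row_(j < n.-1) if unlift ord0 j is Some i then z i else b + q) ->
  @Wn R p n (mkv a b z).
Proof.
move=> aq hS; exists (mkv a (b + q) z); last first.
  apply: eq_coords => [||i]; rewrite ?(vx_mkv, vy_mkv, vz_mkv).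
  - by rewrite /vx !mxE /= unlift_none mulr0 subr0.
  - by rewrite /vy !mxE /= liftK unlift_none mulr1 addrK.
  - by rewrite /vz !mxE /= !liftK mulr0 subr0.
split.
  rewrite (coordE _ (ord0 : 'I_n)) -/(vx _) vx_mkv /= in_itv /=.
  by rewrite -ler_norml.
move: hS; congr (Sn p); apply/rowP => j; rewrite !mxE.
by rewrite (coordE _ (lift ord0 j : 'I_n)) mxE liftK.
Qed.

(** The vertices with [y = -q - 1/p] or [y = -q] lie in [Wn] over vertices of [Sn]; the others are
    pentagon vertices or basis vectors in [Pn]. *)
Lemma Hpoly_sub_Hn : Hpoly (r := r) pR `<=` @Hn R p n.
Proof.
have q1 : 1 <= q := q_ge1 p1.
have qn0 : `|q| = q by rewrite ger0_norm // (le_trans ler01).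
have inP x : pentagon p x -> @Hn R p n (mkv (x 0 0) (x 0 1) (fun=> 0)).
  move=> hx; apply: sub_conv; right; apply: sub_conv; left.
  by exists x => //; rewrite pad_mkv.
have inW a b z : @Wn R p n (mkv a b z) -> @Hn R p n (mkv a b z).
  by move=> h; apply: sub_conv; left.
have S0 : Sn p (\row_(j < n.-1) if unlift ord0 j is Some i then 0 else - q - pR^-1 + q).
  apply: sub_conv; left; right; apply/rowP => j; rewrite !mxE.
  case: unliftP => [i ->|->] /=; first by rewrite mulr0 oppr0.
  by rewrite mulr1; ring.
have Sz i : Sn p (\row_(j < n.-1) if unlift ord0 j is Some j1 then (i == j1)%:R else - q + q).
  apply: sub_conv; right; exists i.+2; first by rewrite /= !ltnS ltn_ord.
  apply/rowP => j; rewrite !mxE; case: unliftP => [j1 ->|->] /=.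
    by rewrite !eqSS eq_sym.
  by rewrite addNr.
apply: (Hpoly_sub p1); first exact: convex_conv.
- move=> c; rewrite !inE -/(qp R p) => /orP[|/orP[|/orP[|/orP[|/orP[|/orP[|]]]]]] /eqP -> /=.
  + by apply: inW; apply: cylinder_Wn; rewrite ?qn0.
  + by apply: inW; apply: cylinder_Wn; rewrite ?normrN ?qn0.
  + have := inP (q *: bvec R 2 1); rewrite !mxE /= mulr1 mulr0; apply.
    by apply: sub_conv; rewrite /= !inE eqxx.
  + have := inP (- (q *: bvec R 2 1)); rewrite !mxE /= mulr1 mulr0 oppr0; apply.
    by apply: sub_conv; rewrite /= !inE eqxx orbT.
  + have := inP ((q - 1) *: bvec R 2 1 + bvec R 2 2).
    rewrite !mxE /= mulr1 mulr0 addr0 add0r; apply.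
    by apply: sub_conv; rewrite /= !inE eqxx !orbT.
  + have := inP (- ((q - 1) *: bvec R 2 1) + bvec R 2 2).
    rewrite !mxE /= mulr1 mulr0 addr0 oppr0 add0r; apply.
    by apply: sub_conv; rewrite /= !inE eqxx !orbT.
  + have := inP ((q / pR) *: bvec R 2 2).
    rewrite !mxE /= mulr1 mulr0; apply.
    by apply: sub_conv; rewrite /= !inE eqxx !orbT.
- move=> c i; rewrite !inE -/(qp R p) => /orP[|/orP[|]] /eqP -> /=.
  + by apply: inW; apply: cylinder_Wn; rewrite ?qn0.
  + by apply: inW; apply: cylinder_Wn; rewrite ?normrN ?qn0.
  + rewrite -bvec_mkv; apply: sub_conv; right; apply: sub_conv; right.
    by exists i.+3 => //=; have := ltn_ord i; lia.
Qed.

Lemma Hn_Hpoly : @Hn R p n = Hpoly (r := r) pR.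
Proof. by apply/seteqP; split; [apply: Hn_sub_Hpoly|apply: Hpoly_sub_Hn]. Qed.

End HnHalfSpaces.

(** * Rationality and full dimension *)

Definition vertex_seq (F : fieldType) (r p : nat) : seq 'rV[F]_r.+2 :=
  [seq mkv c.1 c.2 (fun=> 0) | c <- base_vertices (p%:R : F)] ++
  [seq mkv c.1 c.2 (fun j => (i == j)%:R) | i <- enum 'I_r,
     c <- top_vertices (p%:R : F)].

Lemma map_base_vertices (F F' : fieldType) (f : {rmorphism F -> F'}) p :
  [seq (f c.1, f c.2) | c <- base_vertices p] = base_vertices (f p).
Proof.
rewrite /base_vertices /= !(rmorph0, rmorph1, rmorphD, rmorphN, rmorphXn, rmorphM).
by rewrite fmorphV.
Qed.

Lemma map_top_vertices (F F' : fieldType) (f : {rmorphism F -> F'}) p :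
  [seq (f c.1, f c.2) | c <- top_vertices p] = top_vertices (f p).
Proof.
by rewrite /top_vertices /= !(rmorph0, rmorph1, rmorphD, rmorphN, rmorphXn).
Qed.

(** The vertices are built by field operations alone, so [ratr] takes the rational list to the real
    one. *)
Lemma map_vertex_seq (F F' : fieldType) (f : {rmorphism F -> F'}) r p :
  [seq map_mx f v | v <- vertex_seq F r p] = vertex_seq F' r p.
Proof.
rewrite /vertex_seq map_cat -[in RHS](rmorph_nat f p).
rewrite -map_base_vertices -map_top_vertices; congr (_ ++ _).
  rewrite -!map_comp; apply: eq_map => c /=.
  by rewrite map_mkv; congr mkv; apply/funext => i /=; rewrite rmorph0.
rewrite map_flatten -map_comp; congr flatten; apply: eq_map => i.
rewrite /comp -!map_comp; apply: eq_map => c /=.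
by rewrite map_mkv; congr mkv; apply/funext => j /=; rewrite rmorph_nat.
Qed.

Lemma rational_polytope_Hn (R : realType) p r :
  (0 < p)%N -> rational_polytope (@Hn R p r.+2).
Proof.
move=> p0; have p1 : 1 <= p%:R :> R by rewrite ler1n.
exists (vertex_seq rat r p).
have -> : [set map_mx ratr v | v in [set` vertex_seq rat r p]] =
    [set` vertex_seq R r p] :> set 'rV[R]_r.+2.
  rewrite -(map_vertex_seq (@ratr R)); apply/seteqP; split=> [_ [v hv <-]|_ /mapP[v hv ->]].
    exact: (map_f (map_mx ratr)).
  by exists v.
rewrite Hn_Hpoly //; apply/seteqP; split.
  apply: Hpoly_sub => // [|c hc|c i hc]; first exact: convex_conv.
    apply: sub_conv; apply: (_ : _ \in vertex_seq R r p).
    by rewrite mem_cat; apply/orP; left; apply/mapP; exists c.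
  apply: sub_conv; apply: (_ : _ \in vertex_seq R r p).
  rewrite mem_cat; apply/orP; right.
  by apply/allpairsPdep; exists i, c; rewrite mem_enum.
apply: conv_sub; first exact: convex_Hpoly.
move=> v; rewrite /mkset mem_cat => /orP[/mapP[c hc ->]|/allpairsPdep[i [c [_ hc ->]]]].
  exact: Hpoly_vertex_base.
exact: Hpoly_vertex_top.
Qed.

Lemma full_dimensional_Hn (R : realType) p r :
  (0 < p)%N -> full_dimensional (@Hn R p r.+2).
Proof.
move=> p0; have p1 : 1 <= p%:R :> R by rewrite ler1n.
have q1 := q_ge1 p1.
(* The points [0, e_1, ..., e_n] all lie in [H_n]; the rows of the identity matrix are the [e_i]. *)
exists 0, 1%:M; rewrite Hn_Hpoly //.
have p2 : p%:R <= p%:R ^+ 2 :> R by nra.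
have q0 : 0 <= p%:R ^+ 2 - p%:R + 1 :> R by lra.
have pq0 : 0 <= p%:R * (p%:R ^+ 2 - p%:R + 1) :> R by rewrite mulr_ge0.
have inH (a b : R) : a \in [:: 0; 1] -> b \in [:: 0; 1] ->
    a + b <= 1 -> Hpoly p%:R (mkv a b (fun _ : 'I_r => 0)).
  move=> ha hb hab.
  have a0 : 0 <= a by move: ha; rewrite !inE => /orP[]/eqP ->.
  have b0 : 0 <= b by move: hb; rewrite !inE => /orP[]/eqP ->.
  rewrite /Hpoly /= vs_mkv vx_mkv vy_mkv big1 // subr0 !mul1r ger0_norm //.
  have pb : 0 <= p%:R * b by rewrite mulr_ge0 // (le_trans ler01).
  split; [by split=> // i; rewrite vz_mkv|lra|lra|lra|].
  (* The slack in the last bound is the expression in [f1] at [e_2], and one more than that in [f2]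
     at [e_1]. *)
  have f1 : 0 <= p%:R * (p%:R - 1) ^+ 2 :> R by rewrite mulr_ge0 ?sqr_ge0.
  have f2 : 0 <= p%:R * (p%:R ^+ 2 - p%:R) :> R by rewrite mulr_ge0 ?subr_ge0.
  move: ha hb hab; rewrite !inE => /orP[]/eqP -> /orP[]/eqP -> hab;
    by rewrite ?(mulr0, mulr1, add0r, addr0); lra.
split=> [||i].
- have -> : 0 = mkv 0 0 (fun=> 0) :> 'rV[R]_r.+2.
    by apply: eq_coords => [||i]; rewrite ?(vx_mkv, vy_mkv, vz_mkv) [LHS]mxE.
  by apply: inH; rewrite ?inE ?eqxx //; lra.
- by rewrite row_free_unit unitmx1.
rewrite add0r; have [i1 ->|->] := unliftP ord0 i; last first.
  have -> : row ord0 1%:M = mkv 1 0 (fun=> 0) :> 'rV[R]_r.+2.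
    by apply: eq_coords => [||j]; rewrite ?(vx_mkv, vy_mkv, vz_mkv) [LHS]mxE mxE.
  by apply: inH; rewrite ?inE ?eqxx ?orbT //; lra.
have [j ->|->] := unliftP ord0 i1; last first.
  have -> : row (lift ord0 ord0) 1%:M = mkv 0 1 (fun=> 0) :> 'rV[R]_r.+2.
    by apply: eq_coords => [||j]; rewrite ?(vx_mkv, vy_mkv, vz_mkv) [LHS]mxE mxE.
  by apply: inH; rewrite ?inE ?eqxx ?orbT //; lra.
have -> : row (lift ord0 (lift ord0 j)) 1%:M =
    mkv 0 0 (fun i => (j == i)%:R) :> 'rV[R]_r.+2.
  by apply: eq_coords => [||k]; rewrite ?(vx_mkv, vy_mkv, vz_mkv) [LHS]mxE mxE.
by apply: (@Hpoly_vertex_top R r p%:R p1 (0, 0)); rewrite !inE eqxx !orbT.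
Qed.

(** * Lattice points *)

Lemma Hpoly_scale (R : realType) r (p k : R) (w : 'rV[R]_r.+2) : 0 < k ->
  let q := p ^+ 2 - p + 1 in
  Hpoly p (k^-1 *: w) <->
  [/\ (forall i, 0 <= vz w i) /\ vs w <= k, `|vx w| <= k * q,
      - (k * (p * q)) - (k - vs w) <= p * vy w,
      `|vx w| + vy w <= (k - vs w) * q
    & p ^+ 2 * vy w + (p - 1) * `|vx w| <= (k - vs w) * (p * q)].
Proof.
move=> k0 q; have kV : k * k^-1 = 1 by rewrite divff // gt_eqF.
have ex : k * `|vx (k^-1 *: w)| = `|vx w|.
  by rewrite /vx mxE normrM (ger0_norm (ltW _)) ?invr_gt0 // mulrA kV mul1r.
have ey : k * vy (k^-1 *: w) = vy w by rewrite /vy mxE mulrA kV mul1r.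
have ez i : k * vz (k^-1 *: w) i = vz w i by rewrite /vz mxE mulrA kV mul1r.
have es : k * vs (k^-1 *: w) = vs w.
  by rewrite /vs mulr_sumr; apply: eq_bigr => i _; apply: ez.
have E1 : (forall i, 0 <= vz (k^-1 *: w) i) <-> (forall i, 0 <= vz w i).
  by split=> h i; have := h i; rewrite -ez pmulr_rge0.
rewrite /Hpoly /= -/q.
rewrite -(ler_pM2l k0 (vs _)) -(ler_pM2l k0 `|_|) -(ler_pM2l k0 (- _ - _)).
rewrite -(ler_pM2l k0 (`|_| + _)) -(ler_pM2l k0 (p ^+ 2 * _ + _)).
have -> : k * (- (p * q) - (1 - vs (k^-1 *: w))) =
  - (k * (p * q)) - (k - k * vs (k^-1 *: w)) by ring.
have -> : k * ((1 - vs (k^-1 *: w)) * q) = (k - k * vs (k^-1 *: w)) * q by ring.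
have -> : k * ((1 - vs (k^-1 *: w)) * (p * q)) =
  (k - k * vs (k^-1 *: w)) * (p * q) by ring.
have -> : k * (p ^+ 2 * vy (k^-1 *: w) + (p - 1) * `|vx (k^-1 *: w)|) =
  p ^+ 2 * (k * vy (k^-1 *: w)) + (p - 1) * (k * `|vx (k^-1 *: w)|) by ring.
rewrite [k * (p * vy _)]mulrCA [k * (`|_| + _)]mulrDr.
rewrite es ex ey mulr1.
by split=> -[[/E1 h0 h1] h2 h3 h4 h5].
Qed.

Lemma dilateP (R : realType) n (k : R) (A : set 'rV[R]_n) v : 0 < k ->
  dilate k A v <-> A (k^-1 *: v).
Proof.
move=> k0; have kn : k != 0 by rewrite gt_eqF.
split=> [[x Ax <-]|Av]; first by rewrite scalerA mulVf // scale1r.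
by exists (k^-1 *: v) => //; rewrite scalerA divff // scale1r.
Qed.

(** After scaling by [k], all coefficients are integers, [q] being [qn p], so the real inequalities
    descend to the integers. *)
Lemma lattice_pointsP (R : realType) r (p k : nat) (v : 'rV[int]_r.+2) :
  (0 < k)%N -> (0 < p)%N -> let s := \sum_i vz v i in
  lattice_points (dilate (k%:Z%:~R : R) (Hpoly p%:R)) v <->
  [/\ (forall i, 0 <= vz v i) /\ s <= k, `|vx v| <= k%:Z * qn p,
      - (k%:Z * (p%:Z * qn p)) - (k%:Z - s) <= p%:Z * vy v,
      `|vx v| + vy v <= (k%:Z - s) * qn p
    & p%:Z ^+ 2 * vy v + p.-1%:Z * `|vx v| <= (k%:Z - s) * (p%:Z * qn p)].
Proof.
move=> k0 p0 s.
have kR : 0 < k%:Z%:~R :> R by rewrite ltr0z.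
set w : 'rV[R]_r.+2 := map_mx intr v.
have ex : vx w = (vx v)%:~R by rewrite /vx mxE.
have ey : vy w = (vy v)%:~R by rewrite /vy mxE.
have ez i : vz w i = (vz v i)%:~R by rewrite /vz mxE.
have es : vs w = s%:~R.
  by rewrite /s rmorph_sum; apply: eq_bigr => i _; apply: ez.
have eq : (p%:R ^+ 2 - p%:R + 1 : R) = (qn p)%:Z%:~R.
  by rewrite /qn; case: p p0 => // p' _ /=; ring.
have ep : (p%:R - 1 : R) = p.-1%:Z%:~R by case: p p0 {eq} => // p' _ /=; ring.
have epp : p%:R = p%:Z%:~R :> R by [].
rewrite /lattice_points /= dilateP // Hpoly_scale // eq ep epp ex ey es.
rewrite -intr_norm; do 3 rewrite -?(rmorphXn intr) -?(rmorphM intr) -?(rmorphN intr)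
  -?(rmorphD intr).
rewrite !ler_int.
have E : (forall i, 0 <= vz w i) <-> (forall i, 0 <= vz v i).
  by split=> h i; have := h i; rewrite ez ler0z.
by split=> -[[/E h0 h1] h2 h3 h4 h5].
Qed.

Definition slice (p k t : nat) : seq (int * int) :=
  [seq (x, y) | x <- irange (- (k * qn p)%:Z) (k * qn p + k * qn p).+1,
     y <- irange (- ((k * qn p)%:Z + (t %/ p)%:Z))
            (absz (topz p t `|x| + (k * qn p)%:Z + (t %/ p)%:Z + 1)%R)].

Lemma size_slice p k t : size (slice p k t) = slice_size p k t.
Proof.
rewrite size_allpairs_dep sumnE big_map; apply: eq_bigr => x _.
exact: size_irange.
Qed.

Lemma slice_uniq p k t : uniq (slice p k t).
Proof.
apply: allpairs_uniq_dep => [|x _|]; [exact: irange_uniq|exact: irange_uniq|].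
by move=> [x y] [x' y'] _ _ /= [-> ->].
Qed.

Lemma mem_slice p k t (x y : int) : (0 < p)%N ->
  ((x, y) \in slice p k t) =
  [&& `|x| <= k%:Z * qn p, - (k%:Z * (p%:Z * qn p)) - t%:Z <= p%:Z * y,
      `|x| + y <= t%:Z * qn p
    & p%:Z ^+ 2 * y + p.-1%:Z * `|x| <= t%:Z * (p%:Z * qn p)].
Proof.
move=> p0.
have -> : ((x, y) \in slice p k t) =
    [&& `|x| <= k%:Z * qn p, - ((k * qn p)%:Z + (t %/ p)%:Z) <= y
      & y <= topz p t `|x|].
  rewrite -PoszM; apply/allpairsPdep/and3P => [[x' [y' [hx hy [-> ->]]]]|[hx hy1 hy2]].
    move: hx hy; rewrite !mem_irange => hx hy.
    have hx' : (`|x'| <= k * qn p)%N by lia.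
    have := topz_lb t p0 hx'; move: hx hy; clear.
    by move: (k * qn p)%N (t %/ p)%N (topz _ _ _) => b d T; split; lia.
  exists x, y; have hx' : (`|x| <= k * qn p)%N by lia.
  have := topz_lb t p0 hx'; move: hx hy1 hy2; rewrite !mem_irange; clear.
  by move: (k * qn p)%N (t %/ p)%N (topz _ _ _) => b d T; split=> //; lia.
congr [&& _ , _ & _].
  (* As [y] is an integer, [t / p] may be rounded down once [- p y - p k q <= t] is divided by
     [p]. *)
  have -> : (- ((k * qn p)%:Z + (t %/ p)%:Z) <= y) =
      (- y - (k * qn p)%:Z <= (t %/ p)%:Z) by lia.
  by rewrite -divz_nat lez_divRL //; apply/idP/idP; nia.
rewrite /topz le_min lez_divRL; last by rewrite ltz_nat muln_gt0 p0.
by congr (_ && _); apply/idP/idP; nia.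
Qed.

Definition lattice_seq (p r k : nat) : seq 'rV[int]_r.+2 :=
  [seq mkv c.1 c.2 (fun i : 'I_r => (nth 0%N z i)%:Z)
    | z <- simplex_seq r k, c <- slice p k (k - sumn z)].

Lemma size_lattice_seq p r k : size (lattice_seq p r k) =
  (\sum_(z <- simplex_seq r k) slice_size p k (k - sumn z))%N.
Proof.
rewrite size_allpairs_dep sumnE big_map; apply: eq_bigr => x _.
exact: size_slice.
Qed.

Lemma lattice_seq_uniq p r k : uniq (lattice_seq p r k).
Proof.
apply: allpairs_uniq_dep => [|z _|]; [exact: simplex_seq_uniq|exact: slice_uniq|].
move=> [z c] [z' c'] /allpairsPdep[z1 [c1 [hz _ e]]] /allpairsPdep[z2 [c2 [hz' _ e']]].
have {e}Ez : z = z1 by case: e.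
have {e'}Ez' : z' = z2 by case: e'.
move: hz hz'; rewrite -{}Ez -{}Ez' !mem_simplex_seq => /andP[/eqP sz _] /andP[/eqP sz' _] /= E.
have Ex := congr1 (@vx _ _) E; have Ey := congr1 (@vy _ _) E.
rewrite !vx_mkv in Ex; rewrite !vy_mkv in Ey.
(* Both lists have length [r], so the [z] coordinates of the vector determine them. *)
have <- : z = z'.
  apply: (@eq_from_nth _ 0%N); rewrite sz ?sz' // => i hi.
  have := congr1 (fun v => vz v (Ordinal hi)) E.
  by rewrite !vz_mkv => -[].
by case: c c' Ex Ey {E} => x y [x' y'] /= -> ->.
Qed.

Lemma mem_lattice_seq (R : realType) p r k (v : 'rV[int]_r.+2) :
  (0 < k)%N -> (0 < p)%N ->
  lattice_points (dilate (k%:Z%:~R : R) (Hpoly p%:R)) v <-> v \in lattice_seq p r k.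
Proof.
move=> k0 p0; rewrite lattice_pointsP //.
have sumnth z : size z = r -> (\sum_(i < r) (nth 0%N z i)%:Z) = (sumn z)%:Z.
  move=> <-; rewrite sumnE (big_nth 0%N) big_mkord.
  by rewrite (big_morph Posz PoszD (erefl _)).
split=> [[[h0 h1] h2 h3 h4 h5]|/allpairsPdep[z [c [hz hc ->]]]].
  pose z := mkseq (fun i => if insub i is Some j then `|vz v j|%N else 0%N) r.
  have sz : size z = r by rewrite size_mkseq.
  have nz (i : 'I_r) : (nth 0%N z i)%:Z = vz v i.
    by rewrite nth_mkseq // valK gez0_abs.
  have Es : \sum_i vz v i = (sumn z)%:Z.
    by rewrite -sumnth //; apply: eq_bigr => i _.
  rewrite Es in h1 h3 h4 h5; have le_zk : (sumn z <= k)%N by lia.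
  apply/allpairsPdep; exists z, (vx v, vy v); split.
  - by rewrite mem_simplex_seq sz eqxx.
  - by rewrite mem_slice // -subzn // h2 h3 h4 h5.
  - by apply: eq_coords => [||i]; rewrite ?(vx_mkv, vy_mkv, vz_mkv).
move: hz hc; rewrite mem_simplex_seq => /andP[/eqP sz le_zk].
case: c => x y; rewrite mem_slice // -subzn // => /and4P[h2 h3 h4 h5] /=.
rewrite vx_mkv vy_mkv.
under eq_bigr do rewrite vz_mkv.
rewrite sumnth //; split=> //; split=> [i|]; last by rewrite lez_nat.
by rewrite vz_mkv.
Qed.

(** * Reading off the period sequence *)

Theorem theorem3p3 (R : realType) (p n : nat) (hp : (0 < p)%N)
    (hn : (3 <= n)%N) :
  [/\ rational_polytope (@Hn R p n),
      full_dimensional (@Hn R p n)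
    & period_sequence (@Hn R p n) [:: 1%N, p & nseq n.-1 1%N]].
Proof.
case: n hn => [|[|r]] // hn.
split; [exact: rational_polytope_Hn|exact: full_dimensional_Hn|].
split; first by rewrite /= size_nseq.
have [Q sQ [psi mpsi hQ]] := slice_sum_quasi_poly r hp.
pose b : rat := 2 * (qn p)%:R.
have b0 : b != 0 by rewrite mulf_neq0 // pnatr_eq0.
(* The term [2 q k psi(k)] joins the coefficient of [k^1]; every other coefficient is a constant
   taken from [Q]. *)
pose c i (k : int) : rat :=
  if i == 1%N then Q`_1 + b * psi `|(k %% p)%Z|%N else Q`_i.
have mc i : (i <= r.+2)%N -> min_period (c i) (nth 0%N [:: 1%N, p & nseq r.+1 1%N] i).
  case: i => [|[|i]] hi.
  - exact: min_period_const.
  - exact: int_min_period.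
  - have -> : nth 0%N [:: 1%N, p & nseq r.+1 1%N] i.+2 = 1%N.
      by rewrite -[LHS]/(nth 0%N (nseq r.+1 1%N) i) nth_nseq -ltnS hi.
    exact: min_period_const.
exists c => //; split=> [i /mc [m0 pm _]|k].
  by exists (nth 0%N [:: 1%N, p & nseq r.+1 1%N] i).
case: k => // k k1; have k0 : (0 < k)%N by [].
rewrite Hn_Hpoly //=.
have -> : lattice_points (dilate (k%:Z%:~R : R) (Hpoly p%:R)) =
    [set` lattice_seq p r k].
  by apply/seteqP; split=> v /= /(mem_lattice_seq R v k0 hp).
split; first exact: finite_seq.
have -> : fset_set [set` lattice_seq p r k] = [fset v in lattice_seq p r k]%fset.
  apply/fsetP => v; rewrite in_fset_set; last exact: finite_seq.
  by rewrite mem_setE [RHS]in_fset.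
rewrite card_fseq undup_id ?lattice_seq_uniq // size_lattice_seq hQ.
(* [Q] has size at most [r + 3 = n + 1], so the indices up to [n] exhaust its coefficients. *)
rewrite (horner_coef_wide _ sQ) /c.
rewrite (bigD1 (lift ord0 ord0)) // [in RHS](bigD1 (lift ord0 ord0)) //=.
rewrite modz_nat absz_nat nperiodic_modn; last by case: mpsi.
rewrite -/b -pmulrn expr1.
rewrite [X in _ = _ + X](eq_bigr (fun i : 'I_r.+3 => Q`_i * k%:R ^+ i)).
  by move: (\sum_(i < _ | _) _) => S; ring.
by move=> i /negPf; rewrite -val_eqE /= => ->.
Qed.
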